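(* Assume the standing setting below, and suppose Assumptions (A1), (A2), (A3) hold with $L_Z>0$. Fix $\sigma\in(\lambda,1)$, $\eta^0>0$ and $\omega\in[0,\bar\omega(\sigma))$. Let $\{z^k\}$ be generated by the quantized algorithm (Q-M), where at every iteration $k$ every quantizer $\mathcal Q_i^k$ satisfies the BC-rule with bias $\eta=\eta^0\sigma^k$ and compression rate $\omega$. Then for all $k=0,1,2,\dots$, $$\sqrt{\mathbb E\big[\|z^k-z^\infty\|_2^2\big]}\le V_0\,\sigma^k,$$ where $$V_0=\max\{c^*,\|z^0-z^\infty\|\}+\frac{L_A\psi\sqrt{md}\,R^2\eta^0}{\sigma-\lambda}\cdot\frac{1+\frac{R\omega}{\sigma}\big[(1+L_C\sigma)\psi-1\big]}{1-\omega/\bar\omega(\sigma)},$$ with $\psi=\max\{1,(2L_C)^{R-1}\}$ and $c^*=\frac{1}{L_Z}\max_{s\in[R]}\|\mathcal C^s(z^0,0)\|_2$.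
   Context: Standing setting. Let $m,d,R\ge 1$ be integers, $p\ge1$, and $\mathcal Z\subseteq\mathbb R^p$. Let $\mathcal C^s:\mathcal Z\times\mathbb R^{md}\to\mathbb R^{md}$ for $s\in[R]=\{1,\dots,R\}$ and $\mathcal A:\mathcal Z\times(\mathbb R^{md})^R\to\mathcal Z$. Define $\tilde{\mathcal A}:\mathcal Z\to\mathcal Z$ by $\tilde{\mathcal A}(z)=\mathcal A(z,c^1(z),\dots,c^R(z))$ where $c^0(z)=0$ and $c^s(z)=\mathcal C^s(z,c^{s-1}(z))$. (A1) $\tilde{\mathcal A}$ has a fixed point $z^\infty\in\mathcal Z$, and there are $\lambda\in(0,1)$ and a norm $\|\cdot\|$ on $\mathbb R^p$ with $\|\cdot\|_2\le\|\cdot\|$ such that $\|\tilde{\mathcal A}(z)-z^\infty\|\le\lambda\|z-z^\infty\|$ for all $z\in\mathcal Z$. (A2) There is $L_A\ge0$ such that for every $s\in[R]$, $\|\mathcal A(z,c^1,\dots,c^s,\dots,c^R)-\mathcal A(z,c^1,\dots,\tilde c^s,\dots,c^R)\|\le L_A\|c^s-\tilde c^s\|_2$ for all $z\in\mathcal Z$ and all $c^1,\dots,c^R,\tilde c^s\in\mathbb R^{md}$. (A3) There are $L_C,L_Z\ge0$ such that for all $s\in[R]$: $\|\mathcal C^s(z,c)-\mathcal C^s(z,c')\|_2\le L_C\|c-c'\|_2$ for all $z\in\mathcal Z$, $c,c'\in\mathbb R^{md}$; and $\|\mathcal C^s(z,c)-\mathcal C^s(z',c)\|_2\le L_Z\|z-z'\|_2$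 for all $z,z'\in\mathcal Z$, $c\in\mathbb R^{md}$. Quantized algorithm (Q-M). Vectors in $\mathbb R^{md}$ are written $x=(x_1,\dots,x_m)$ with $x_i\in\mathbb R^d$ (agent $i$'s block). At iteration $k$ each agent $i$ uses a (possibly random) quantizer $\mathcal Q_i^k:\mathbb R^d\to\mathbb R^d$, and $\mathcal Q^k(x)=(\mathcal Q^k_1(x_1),\dots,\mathcal Q^k_m(x_m))$. Start with $z^0\in\mathcal Z$ and $\hat c^{-1,s}=0$ for $s\in[R]$. For $k=0,1,\dots$: set $\hat c^{k,0}=0$; for $s=1,\dots,R$: $c^{k,s}=\mathcal C^s(z^k,\hat c^{k,s-1})$ and $\hat c^{k,s}=\hat c^{k-1,s}+\mathcal Q^k(c^{k,s}-\hat c^{k-1,s})$; then $z^{k+1}=\mathcal A(z^k,\hat c^{k,1},\dots,\hat c^{k,R})$. The randomness of the quantizers is such that each application of a quantizer, conditionally on all previously generated random variables, satisfies the stated BC-rule inequality. BC-rule: a (possibly random) map $\mathcal Q:\mathbb R^d\to\mathbb R^d$ satisfies the biased compression rule with bias $\eta\ge0$ and compression rate $\omega\in[0,1)$ if $\sqrt{\mathbb E[\|\mathcal Q(x)-x\|_2^2]}\le\sqrt d\,\eta+\omega\|x\|_2$ for all $x\in\mathbb R^d$ (for deterministic $\mathcal Q$ the expectation is trivial). Threshold: $\bar\omega(\sigma)=\frac{\sigma}{R}\cdot\frac{\sigma-\lambda}{\sigma-\lambda+2L_AL_Z\big[R\max\{1,(2L_C)^{R-1}\}\big]^2}$. *)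

(* Defs.v *)
From HB Require Import structures.
From mathcomp Require Import all_boot all_order all_algebra.
From mathcomp Require Import all_classical all_reals all_analysis.
Set Implicit Arguments. Unset Strict Implicit. Unset Printing Implicit Defensive.
Import Order.TTheory GRing.Theory Num.Theory.
Local Open Scope ring_scope.
Local Open Scope classical_set_scope.

(* Vectors of R^p are row vectors 'rV[R]_p.  Vectors of R^{md} are m x d
   matrices: row i is agent i's block x_i in R^d. *)

Section Defs.
Variable R : realType.

Definition norm2 (a b : nat) (x : 'M[R]_(a, b)) : R :=
  Num.sqrt (\sum_(i < a) \sum_(j < b) x i j ^+ 2).

Definition is_norm (p : nat) (nrm : 'rV[R]_p -> R) : Prop :=
  [/\ forall x y, nrm (x + y) <= nrm x + nrm y,
      forall (a : R) x, nrm (a *: x) = `|a| * nrm x &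
      forall x, nrm x = 0 -> x = 0].

Variables (p m d nR : nat).
Notation Vp := 'rV[R]_p.
Notation Vmd := 'M[R]_(m, d).

(* C s  is the paper's C^{s+1}, s : 'I_nR ;  A z c  with c : 'I_nR -> Vmd. *)
Variable C : 'I_nR -> Vp -> Vmd -> Vmd.
Variable A : Vp -> ('I_nR -> Vmd) -> Vp.

Fixpoint cchain (z : Vp) (n : nat) : Vmd :=
  match n with
  | 0 => 0
  | n'.+1 => match insub n' with
             | Some s => C s z (cchain z n')
             | None => cchain z n'
             end
  end.

Definition Atilde (z : Vp) : Vp := A z (fun s : 'I_nR => cchain z (val s).+1).

Definition blockQ (q : 'I_m -> 'rV[R]_d -> 'rV[R]_d) (x : Vmd) : Vmd :=
  \matrix_(i < m) q i (row i x).

(* One inner sweep of (Q-M) at iteration k, given z = z^k,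
   prev = (hat c^{k-1,s})_s and the quantizers qk s (quantizer applied at the
   s-th inner round).  qinner n = hat c^{k,n}  (n = 0..nR). *)
Fixpoint qinner (z : Vp) (prev : 'I_nR -> Vmd)
    (qk : 'I_nR -> 'I_m -> 'rV[R]_d -> 'rV[R]_d) (n : nat) : Vmd :=
  match n with
  | 0 => 0
  | n'.+1 => match insub n' with
             | Some s => prev s + blockQ (qk s) (C s z (qinner z prev qk n') - prev s)
             | None => qinner z prev qk n'
             end
  end.

(* state at iteration k : (z^k, (hat c^{k-1,s})_s), with hat c^{-1,s} = 0 *)
Fixpoint qm_state (z0 : Vp) (q : nat -> 'I_nR -> 'I_m -> 'rV[R]_d -> 'rV[R]_d)
    (k : nat) : Vp * ('I_nR -> Vmd) :=
  match k with
  | 0 => (z0, fun _ => 0)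
  | k'.+1 => let: (z, prev) := qm_state z0 q k' in
             let ch := fun s : 'I_nR => qinner z prev (q k') (val s).+1 in
             (A z ch, ch)
  end.

Definition qm_z z0 q k : Vp := (qm_state z0 q k).1.
(* hat c^{k,s}  (s : 'I_nR is the paper's s+1) *)
Definition qm_chat z0 q k (s : 'I_nR) : Vmd := (qm_state z0 q k.+1).2 s.
Definition qm_c z0 q k (s : 'I_nR) : Vmd :=
  let: (z, prev) := qm_state z0 q k in C s z (qinner z prev (q k) (val s)).
Definition qm_prev z0 q k (s : 'I_nR) : Vmd := (qm_state z0 q k).2 s.

Definition psi_const (LC : R) : R := Num.max 1 ((2 * LC) ^+ (nR.-1)).
Definition omega_bar (lam LA LZ LC sigma : R) : R :=
  sigma / nR%:R * ((sigma - lam) /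
     (sigma - lam + 2 * LA * LZ * (nR%:R * psi_const LC) ^+ 2)).

End Defs.

Definition mx_measurable_wrt {R : realType} (T : Type) (G : set (set T))
    (a b : nat) (X : T -> 'M[R]_(a, b)) : Prop :=
  forall (i : 'I_a) (j : 'I_b) (B : set R), measurable B ->
    G ((fun w => X w i j) @^-1` B).

Definition before (k' s' k s : nat) : bool :=
  (k' < k)%N || ((k' == k) && (s' < s)%N).

Definition qsample {R : realType} (T : Type) (m d nR : nat)
    (Q : nat -> 'I_nR -> 'I_m -> T -> 'rV[R]_d -> 'rV[R]_d) (w : T) :
    nat -> 'I_nR -> 'I_m -> 'rV[R]_d -> 'rV[R]_d :=
  fun k s i => Q k s i w.

(* Main.v *)
(* Measured in L^2, write [u_{k,s} = |c^{k,s} - hat c^{k-1,s}|] and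
   [e_{k,s} = |hat c^{k,s} - c^{k,s}|], and put [h = sqrt(md) eta0].  The BC-rule
   and Minkowski's inequality give [e_{k,s} <= h sigma^k + om u_{k,s}].
   Lipschitz continuity gives, for [k >= 1],
     u_{k,s} <= e_{k-1,s} + LZ |z^k - z^{k-1}| + LC (e_{k,s-1} + u_{k,s-1}),
   and [|z^{k+1} - zinf| <= lam |z^k - zinf| + LA sum_s sum_{t<=s} LC^{s-t} e_{k,t}].
   These inequalities propagate the bounds [u_{k,s} <= nu_s sigma^k] and
   [|z^k - zinf| <= V sigma^k], where [nu] solves
     (1 - om/sigma) nu_s = b + 2 LC nu_{s-1}
   with [b = (1 + sigma LC) h / sigma + 2 LZ V / sigma].  The factors
   [(1 - om/sigma)^{-j}], [j <= nR], cost only [1 / (1 - nR om / sigma)] by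
   Bernoulli's inequality, and this loss is exactly what yields the threshold
   [omega_bar] and the constant [V0]. *)
Require Import Defs.
From HB Require Import structures.
From mathcomp Require Import all_boot all_order all_algebra.
From mathcomp Require Import ring.
From mathcomp Require Import all_classical all_reals all_analysis.
From mathcomp Require Import measurable_realfun.
Set Implicit Arguments. Unset Strict Implicit. Unset Printing Implicit Defensive.
Import Order.TTheory GRing.Theory Num.Theory.
Local Open Scope ring_scope.
Local Open Scope classical_set_scope.

(** * Euclidean norm of matrices and its splitting into rows *)

Lemma sum_cauchy_schwarz (R : realType) (I : finType) (a b : I -> R) :
  (\sum_i a i * b i) ^+ 2 <= (\sum_i a i ^+ 2) * (\sum_i b i ^+ 2).
Proof.
set S := \sum_i a i * b i; set A := \sum_i a i ^+ 2; set B := \sum_i b i ^+ 2.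
have B0 : 0 <= B by apply: sumr_ge0 => i _; exact: sqr_ge0.
(* [B] times the Cauchy-Schwarz defect is a sum of squares. This settles [B != 0]; when [B = 0]
   every [b i] vanishes, hence so does [S]. *)
have E : \sum_i (B * a i - S * b i) ^+ 2 = B * (A * B - S ^+ 2).
  transitivity (\sum_i (B ^+ 2 * a i ^+ 2 - 2 * B * S * (a i * b i)
                        + S ^+ 2 * b i ^+ 2)).
    by apply: eq_bigr => i _; ring.
  by rewrite !big_split /= sumrN -!mulr_sumr -/S -/A -/B; ring.
have : 0 <= B * (A * B - S ^+ 2) by rewrite -E sumr_ge0// => i _; exact: sqr_ge0.
have [B_eq0 _|Bn0] := eqVneq B 0.
  have b0 i : b i = 0.
    apply/eqP; rewrite -sqrf_eq0; apply: contraTT isT => bi.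
    have : B != 0.
      by rewrite /B (bigD1 i)//= gt_eqF// ltr_wpDr ?sumr_ge0// => *;
        rewrite ?sqr_ge0// lt_def bi sqr_ge0.
    by rewrite B_eq0 eqxx.
  by rewrite /S big1 ?expr0n/= ?B_eq0 ?mulr0// => i _; rewrite b0 mulr0.
by rewrite pmulr_rge0 ?subr_ge0// lt_def Bn0.
Qed.

Lemma norm2_ge0 (R : realType) a b (x : 'M[R]_(a, b)) : 0 <= norm2 x.
Proof. exact: sqrtr_ge0. Qed.

Lemma sqr_norm2 (R : realType) a b (x : 'M[R]_(a, b)) :
  norm2 x ^+ 2 = \sum_i \sum_j x i j ^+ 2.
Proof.
by rewrite sqr_sqrtr// sumr_ge0// => i _; rewrite sumr_ge0// => j _; exact: sqr_ge0.
Qed.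

Lemma norm2_0 (R : realType) a b : norm2 (0 : 'M[R]_(a, b)) = 0.
Proof.
by rewrite /norm2 big1 ?sqrtr0// => i _; rewrite big1// => j _; rewrite mxE expr0n.
Qed.

Lemma norm2N (R : realType) a b (x : 'M[R]_(a, b)) : norm2 (- x) = norm2 x.
Proof.
by congr Num.sqrt; apply: eq_bigr => i _; apply: eq_bigr => j _; rewrite mxE sqrrN.
Qed.

Lemma norm2D (R : realType) a b (x y : 'M[R]_(a, b)) :
  norm2 (x + y) <= norm2 x + norm2 y.
Proof.
rewrite -ler_sqr ?nnegrE ?addr_ge0 ?norm2_ge0// sqrrD.
have -> : norm2 (x + y) ^+ 2 =
    norm2 x ^+ 2 + (\sum_i \sum_j x i j * y i j) *+ 2 + norm2 y ^+ 2.
  rewrite !sqr_norm2 -sumrMnl -!big_split/=; apply: eq_bigr => i _.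
  rewrite -sumrMnl -!big_split/=; apply: eq_bigr => j _.
  by rewrite mxE sqrrD.
rewrite lerD2r lerD2l ler_wMn2r// (le_trans (ler_norm _))//.
rewrite -ler_sqr ?nnegrE ?mulr_ge0 ?norm2_ge0// real_normK ?num_real//.
rewrite exprMn !sqr_norm2 !pair_bigA; exact: sum_cauchy_schwarz.
Qed.

Lemma norm2_sub (R : realType) a b (x y : 'M[R]_(a, b)) :
  norm2 (x - y) = norm2 (y - x).
Proof. by rewrite -norm2N opprB. Qed.

Lemma norm2_dist (R : realType) a b (x y z : 'M[R]_(a, b)) :
  norm2 (x - z) <= norm2 (x - y) + norm2 (y - z).
Proof. by rewrite -{1}(subrK y x) -addrA norm2D. Qed.

Lemma sqr_norm2_rows (R : realType) a b (x : 'M[R]_(a, b)) :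
  norm2 x ^+ 2 = \sum_i norm2 (row i x) ^+ 2.
Proof.
rewrite sqr_norm2; apply: eq_bigr => i _; rewrite sqr_norm2 big_ord1.
by apply: eq_bigr => j _; rewrite mxE.
Qed.

(** Passes from the agents' blocks to the whole vector. After expansion only the cross terms differ,
    and Cauchy-Schwarz against the constant vector 1 bounds them. The bias grows by [Num.sqrt m%:R],
    the rate [w] does not grow. *)
Lemma sum_sqr_affine_le (R : realType) (m : nat) (c w rho : R) (r : 'I_m -> R) :
  0 <= c -> 0 <= w -> 0 <= rho -> \sum_i r i ^+ 2 = rho ^+ 2 ->
  \sum_i (c + w * r i) ^+ 2 <= (Num.sqrt m%:R * c + w * rho) ^+ 2.
Proof.
move=> c0 w0 rho0 sr.
have r_le : \sum_i r i <= Num.sqrt m%:R * rho.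
  rewrite (le_trans (ler_norm _))// -ler_sqr ?nnegrE ?mulr_ge0 ?sqrtr_ge0//.
  rewrite real_normK ?num_real// exprMn sqr_sqrtr ?ler0n// -sr.
  have := sum_cauchy_schwarz (fun=> 1) r.
  by under eq_bigr do rewrite mul1r; rewrite expr1n sumr_const card_ord.
have -> : \sum_i (c + w * r i) ^+ 2 =
    m%:R * c ^+ 2 + 2 * c * w * (\sum_i r i) + w ^+ 2 * rho ^+ 2.
  rewrite -sr !mulr_sumr mulr_natl -[in X in _ = X + _ + _](card_ord m).
  rewrite -sumr_const -!big_split/=.
  by apply: eq_bigr => i _; ring.
have -> : (Num.sqrt m%:R * c + w * rho) ^+ 2 = 
    m%:R * c ^+ 2 + 2 * c * w * (Num.sqrt m%:R * rho) + w ^+ 2 * rho ^+ 2.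
  have : Num.sqrt m%:R ^+ 2 = m%:R :> R by rewrite sqr_sqrtr.
  by set q := Num.sqrt _ => <-; ring.
by rewrite lerD2r lerD2l ler_wpM2l// !mulr_ge0.
Qed.

(** * Measurability and second moments *)

Lemma measurable_sqrtr (R : realType) : measurable_fun setT (@Num.sqrt R).
Proof. by apply: continuous_measurable_fun; exact: sqrt_continuous. Qed.

Lemma measurable_norm2 {d} {T : measurableType d} (R : realType) a b
    (X : T -> 'M[R]_(a, b)) :
  (forall i j, measurable_fun setT (fun w => X w i j)) ->
  measurable_fun setT (fun w => norm2 (X w)).
Proof.
move=> mX; apply: measurableT_comp; first exact: measurable_sqrtr.
apply: measurable_sum => i; apply: measurable_sum => j.
exact: measurable_funX.
Qed.

(** Bridge to the L2 norm, for which Minkowski's inequality is available. *)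
Lemma int_sqr_leP {d} {T : measurableType d} (R : realType)
    (mu : {measure set T -> \bar R}) (f : T -> R) (b : R) : 0 <= b ->
  ((\int[mu]_w (f w ^+ 2)%:E <= (b ^+ 2)%:E) <->
   ('N[mu]_2%:E[EFin \o f] <= b%:E))%E.
Proof.
move=> b0.
have E : ('N[mu]_2%:E[EFin \o f] `^ 2 = \int[mu]_w (f w ^+ 2)%:E)%E.
  rewrite poweR_Lnorm//; apply: eq_integral => w _ /=.
  by rewrite powR_mulrn// real_normK// num_real.
have N0 : (0 <= 'N[mu]_2%:E[EFin \o f])%E by exact: Lnorm_ge0.
have I0 : (0 <= \int[mu]_w (f w ^+ 2)%:E)%E.
  by apply: integral_ge0 => w _; rewrite lee_fin sqr_ge0.
have bE : ((b ^+ 2)%:E = b%:E `^ 2)%E by rewrite poweR_EFin powR_mulrn.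
rewrite -E bE; case: ('N[mu]_2%:E[EFin \o f])%E N0 => [r||]//= r0.
- by rewrite !lee_fin !powR_mulrn// ler_sqr ?nnegrE//.
- by rewrite pnatr_eq0/= !leye_eq.
Qed.

(** * Calculus of L2 bounds for random scalars *)

Section L2Dominated.
Context {d : measure_display} {T : measurableType d} {R : realType}.
Variable P : probability T R.

(* The domination makes the notion stable under pointwise comparison without
   any measurability requirement on [X]; thus the norm of (A1), which is not
   known to be a measurable function, can be handled directly. *)
Definition L2_dominated (X : T -> R) (b : R) : Prop :=
  exists Y : T -> R, [/\ measurable_fun setT Y, forall w, 0 <= X w <= Y w,
    0 <= b & (\int[P]_w (Y w ^+ 2)%:E <= (b ^+ 2)%:E)%E].

Lemma L2_dominated_le (X X' : T -> R) (b b' : R) : L2_dominated X' b' ->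
  (forall w, 0 <= X w <= X' w) -> b' <= b -> L2_dominated X b.
Proof.
move=> [Y [mY X'Y b'0 iY]] XX' b'b; exists Y; split=> //.
- move=> w; have /andP[-> /= h] := XX' w.
  by have /andP[_] := X'Y w; exact: le_trans.
- exact: le_trans b'b.
- by apply: le_trans iY _; rewrite lee_fin ler_sqr ?nnegrE// (le_trans b'0).
Qed.

Lemma L2_dominated_cst (c : R) : 0 <= c -> L2_dominated (fun=> c) c.
Proof.
move=> c0; exists (fun=> c); split=> //; first by move=> w; rewrite c0 lexx.
by rewrite integral_cst// [X in (_ * X)%E]probability_setT mule1.
Qed.

Lemma L2_dominatedD (X X' : T -> R) (b b' : R) :
  L2_dominated X b -> L2_dominated X' b' ->
  L2_dominated (fun w => X w + X' w) (b + b').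
Proof.
move=> [Y [mY XY b0 iY]] [Y' [mY' XY' b'0 iY']].
exists (fun w => Y w + Y' w); split.
- exact: measurable_funD.
- move=> w; have /andP[? ?] := XY w; have /andP[? ?] := XY' w.
  by rewrite addr_ge0//= lerD.
- exact: addr_ge0.
- apply/int_sqr_leP; first exact: addr_ge0.
  rewrite (le_trans (minkowski_EFin P mY mY' _))// ?ler1n// (EFinD b b').
  by rewrite leeD//; exact/int_sqr_leP.
Qed.

Lemma L2_dominatedZ (k : R) (X : T -> R) (b : R) : 0 <= k ->
  L2_dominated X b -> L2_dominated (fun w => k * X w) (k * b).
Proof.
move=> k0 [Y [mY XY b0 iY]]; exists (fun w => k * Y w); split.
- exact: measurable_funM.
- move=> w; have /andP[? ?] := XY w.
  by rewrite mulr_ge0//= ler_wpM2l.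
- exact: mulr_ge0.
- under eq_integral do rewrite exprMn EFinM.
  rewrite ge0_integralZl_EFin ?sqr_ge0//.
  + by rewrite exprMn (EFinM (k ^+ 2)); apply: lee_wpmul2l => //; rewrite lee_fin sqr_ge0.
  + by move=> w _; rewrite lee_fin sqr_ge0.
  + by apply/measurable_EFinP; exact: measurable_funX.
Qed.

Lemma L2_dominated_sum (n : nat) (X : 'I_n -> T -> R) (b : 'I_n -> R) :
  (forall i, L2_dominated (X i) (b i)) ->
  L2_dominated (fun w => \sum_i X i w) (\sum_i b i).
Proof.
elim: n => [|n ih] in X b * => Xb.
  rewrite big_ord0; apply: L2_dominated_le (L2_dominated_cst (lexx 0)) _ _ => //.
  by move=> w; rewrite big_ord0 lexx.
rewrite big_ord_recl.
apply: L2_dominated_le (L2_dominatedD (Xb ord0) (ih _ _ (fun i => Xb (lift ord0 i)))) _ (lexx _).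
move=> w; rewrite big_ord_recl lexx andbT addr_ge0 ?sumr_ge0//.
  by have [Y [_ /(_ w)/andP[]]] := Xb ord0.
by move=> i _; have [Y [_ /(_ w)/andP[]]] := Xb (lift ord0 i).
Qed.

Lemma L2_dominated_integral (X : T -> R) (b : R) : measurable_fun setT X ->
  L2_dominated X b -> (\int[P]_w (X w ^+ 2)%:E <= (b ^+ 2)%:E)%E.
Proof.
move=> mX [Y [mY XY b0 iY]]; apply: le_trans iY; apply: ge0_le_integral => //.
- by move=> w _; rewrite lee_fin sqr_ge0.
- by apply/measurable_EFinP; exact: measurable_funX.
- by apply/measurable_EFinP; exact: measurable_funX.
- move=> w _; have /andP[X0 XYw] := XY w.
  by rewrite lee_fin ler_sqr ?nnegrE// (le_trans X0).
Qed.

(** The second moments of the rows are summed, [sum_sqr_affine_le] is applied at each outcome, and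
    Minkowski's inequality replaces the random [norm2 (x t)] by its L2 bound [nu]. *)
Lemma quantization_error_L2 (a b : nat) (x e : T -> 'M[R]_(a, b)) (c w nu : R) :
  0 <= c -> 0 <= w ->
  (forall i j, measurable_fun setT (fun t => x t i j)) ->
  (forall i j, measurable_fun setT (fun t => e t i j)) ->
  (forall i, \int[P]_t (norm2 (row i (e t)) ^+ 2)%:E <=
             \int[P]_t ((c + w * norm2 (row i (x t))) ^+ 2)%:E)%E ->
  L2_dominated (fun t => norm2 (x t)) nu ->
  L2_dominated (fun t => norm2 (e t)) (Num.sqrt a%:R * c + w * nu).
Proof.
move=> c0 w0 mx me rows xnu.
have mrow (y : T -> 'M[R]_(a, b)) i :
    (forall i j, measurable_fun setT (fun t => y t i j)) ->
    measurable_fun setT (fun t => norm2 (row i (y t))).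
  move=> my; apply: measurable_norm2 => i' j.
  by under eq_fun do rewrite mxE; exact: my.
have L2c : L2_dominated (fun t => Num.sqrt a%:R * c + w * norm2 (x t))
    (Num.sqrt a%:R * c + w * nu).
  apply: L2_dominatedD; last exact: L2_dominatedZ.
  by apply: L2_dominated_cst; rewrite mulr_ge0// sqrtr_ge0.
exists (fun t => norm2 (e t)); split.
- exact: measurable_norm2.
- by move=> t; rewrite norm2_ge0 lexx.
- by have [Y []] := L2c.
- have mc : measurable_fun setT (fun t => Num.sqrt a%:R * c + w * norm2 (x t)).
    apply: measurable_funD => //; apply: measurable_funM => //.
    exact: measurable_norm2.
  apply: le_trans (L2_dominated_integral mc L2c).
  have mci i : measurable_fun setT
      (fun t => ((c + w * norm2 (row i (x t))) ^+ 2)%:E).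
    apply/measurable_EFinP/measurable_funX; apply: measurable_funD => //.
    by apply: measurable_funM => //; exact: mrow.
  under eq_integral do rewrite sqr_norm2_rows -sumEFin.
  rewrite ge0_integral_sum//; last 2 first.
  + by move=> i; apply/measurable_EFinP/measurable_funX; exact: mrow.
  + by move=> i t _; rewrite lee_fin sqr_ge0.
  apply: (@le_trans _ _ (\sum_i \int[P]_t ((c + w * norm2 (row i (x t))) ^+ 2)%:E)%E).
    by apply: lee_sum => i _; exact: rows.
  rewrite -ge0_integral_sum//; last by move=> i t _; rewrite lee_fin sqr_ge0.
  apply: ge0_le_integral => //.
  + by move=> t _; apply: sume_ge0 => i _; rewrite lee_fin sqr_ge0.
  + exact: emeasurable_sum.
  + by apply/measurable_EFinP; exact: measurable_funX.
  + move=> t _; rewrite sumEFin lee_fin.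
    by apply: sum_sqr_affine_le; rewrite ?norm2_ge0// -sqr_norm2_rows.
Qed.

End L2Dominated.

(** * Scalar recursion over the rounds and the inequalities between the constants *)

Section Constants.
Variables (R : realType).

(** Powers of [2 * LC] are monotone in the exponent, so the largest one is the first or the last. *)
Lemma geometric_le_psi (nR j : nat) (LC : R) : 0 <= LC -> (j < nR)%N ->
  (2 * LC) ^+ j <= psi_const nR LC.
Proof.
move=> LC0 jn; rewrite /psi_const le_max.
have [LC1|LC1] := lerP (2 * LC) 1; first by rewrite exprn_ile1// mulr_ge0.
by rewrite ler_weXn2l ?orbT// ?ltW// -ltnS prednK// (leq_trans _ jn).
Qed.

Lemma psi_ge1 (nR : nat) (LC : R) : 1 <= psi_const nR LC.
Proof. by rewrite /psi_const le_max lexx. Qed.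

Lemma bernoulli_inequality (x : R) (n : nat) : 0 <= x <= 1 ->
  1 - n%:R * x <= (1 - x) ^+ n.
Proof.
move=> /andP[x0 x1]; elim: n => [|n ih]; first by rewrite mul0r subr0 expr0.
rewrite exprS.
apply: (@le_trans _ _ ((1 - x) * (1 - n%:R * x))); last first.
  by rewrite ler_wpM2l// subr_ge0.
rewrite -subr_ge0 -natr1.
have -> : (1 - x) * (1 - n%:R * x) - (1 - (n%:R + 1) * x) = n%:R * x ^+ 2 by ring.
by rewrite mulr_ge0// sqr_ge0.
Qed.

(* Solution of [q * nu s = b + g * nu (s - 1)], [q * nu 0 = b]. *)
Definition round_gain (b g q : R) (s : nat) : R :=
  b * \sum_(j < s.+1) g ^+ j / q ^+ j.+1.

Lemma round_gain0 (b g q : R) : q != 0 -> q * round_gain b g q 0 = b.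
Proof. by move=> q0; rewrite /round_gain big_ord1; field. Qed.

Lemma round_gainS (b g q : R) (s : nat) : q != 0 ->
  q * round_gain b g q s.+1 = b + g * round_gain b g q s.
Proof.
move=> q0; rewrite /round_gain big_ord_recl mulrDr mulrDr; congr (_ + _).
  by rewrite expr0; field.
rewrite !mulr_sumr; apply: eq_bigr => j _ /=.
rewrite /bump leq0n add1n !exprS; field.
by rewrite q0 expf_neq0.
Qed.

Lemma round_gain_ge0 (b g q : R) (s : nat) : 0 <= b -> 0 <= g -> 0 <= q ->
  0 <= round_gain b g q s.
Proof.
move=> b0 g0 q0; rewrite mulr_ge0// sumr_ge0// => j _.
by rewrite divr_ge0 ?exprn_ge0.
Qed.

Lemma round_gain_le (nR s : nat) (b LC x : R) : 0 <= b -> 0 <= LC -> 0 <= x ->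
  nR%:R * x < 1 -> (s < nR)%N ->
  round_gain b (2 * LC) (1 - x) s <=
    b * (nR%:R * (psi_const nR LC / (1 - nR%:R * x))).
Proof.
move=> b0 LC0 x0 nx1 snR; rewrite ler_wpM2l//.
have nR0 : (0 < nR)%N by exact: leq_trans snR.
have x1 : x < 1 by apply: le_lt_trans nx1; rewrite ler_peMl// ler1n.
have q0 : 0 < 1 - x by rewrite subr_gt0.
have psi0 : 0 <= psi_const nR LC by rewrite (le_trans ler01)// psi_ge1.
have K0 : 0 <= psi_const nR LC / (1 - nR%:R * x).
  by rewrite divr_ge0// subr_ge0 ltW.
apply: (@le_trans _ _ (\sum_(j < s.+1) psi_const nR LC / (1 - nR%:R * x))).
  apply: ler_sum => j _; have jnR : (j < nR)%N by exact: leq_trans (ltn_ord j) snR.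
  apply: ler_pM; rewrite ?exprn_ge0 ?invr_ge0 ?exprn_ge0 ?mulr_ge0 ?(ltW q0)//.
    exact: geometric_le_psi.
  (* As [j.+1 <= nR], the power [(1 - x) ^+ j.+1] is at least [(1 - x) ^+ nR], and Bernoulli's
     inequality bounds the latter below independently of the round. *)
  rewrite lef_pV2 ?posrE ?subr_gt0 ?exprn_gt0//.
  apply: le_trans (bernoulli_inequality nR _) _; first by rewrite x0 ltW.
  by apply: ler_wiXn2l => //; rewrite ?(ltW q0)// gerBl.
by rewrite sumr_const card_ord -[leLHS]mulr_natl; apply: ler_wpM2r; rewrite ?ler_nat.
Qed.

(** The second factor of [omega_bar] is at most 1, whence [om < sigma / nR%:R]. *)
Lemma omega_bar_rate (nR : nat) (lam LA LZ LC sigma om : R) :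
  (0 < nR)%N -> 0 < lam < sigma -> 0 <= LA -> 0 <= LZ ->
  0 <= om < omega_bar nR lam LA LZ LC sigma ->
  nR%:R * (om / sigma) < 1.
Proof.
move=> nR0 /andP[lam0 ls] LA0 LZ0 /andP[om0]; rewrite /omega_bar.
have s0 : 0 < sigma by exact: lt_trans ls.
set D := 2 * LA * LZ * _.
have D0 : 0 <= D by rewrite mulr_ge0 ?sqr_ge0// mulr_ge0// mulr_ge0.
have Rp : 0 < nR%:R :> R by rewrite ltr0n.
move=> omlt; rewrite mulrA ltr_pdivrMr// mul1r mulrC -ltr_pdivlMr//.
apply: lt_le_trans omlt _; rewrite ler_piMr//; first by rewrite divr_ge0 ?ltW.
by rewrite ler_pdivrMr ?mul1r ?lerDl// ltr_wpDr// subr_gt0.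
Qed.

(** Since [N] depends on [V] through [b], the bound to close is affine in [V]. Multiplying by
    [1 - x] clears the denominator of [N]; the term [x * D * V] then appears on both sides and
    cancels, which leaves [Vy]. *)
Lemma V0_dominates (nR : nat) (lam LA LC LZ sigma om h M : R) :
  (0 < nR)%N -> 0 < lam < sigma -> 0 <= LA -> 0 <= LC -> 0 <= LZ ->
  0 <= om < omega_bar nR lam LA LZ LC sigma -> 0 <= h -> 0 <= M ->
  let psi := psi_const nR LC in
  let V := M + LA * psi * h * nR%:R ^+ 2 / (sigma - lam) *
            ((1 + nR%:R * om / sigma * ((1 + LC * sigma) * psi - 1)) /
             (1 - om / omega_bar nR lam LA LZ LC sigma)) in
  let b := (1 + sigma * LC) * h / sigma + 2 * LZ * V / sigma in
  let N := b * (nR%:R * (psi / (1 - nR%:R * (om / sigma)))) in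
  M <= V /\ LA * (nR%:R * ((h + om * N) * (nR%:R * psi))) <= (sigma - lam) * V.
Proof.
move=> nR0 lams LA0 LC0 LZ0 omb h0 M0 psi.
set x := nR%:R * (om / sigma).
set y := 1 - om / omega_bar nR lam LA LZ LC sigma.
set G := 1 + nR%:R * om / sigma * ((1 + LC * sigma) * psi - 1).
move=> V b N.
have x1 : x < 1 := omega_bar_rate nR0 lams LA0 LZ0 omb.
have /andP[lam0 ls] := lams; have /andP[om0 omlt] := omb.
have s0 : 0 < sigma by exact: lt_trans ls.
have Rp : 0 < nR%:R :> R by rewrite ltr0n.
have psi1 : 1 <= psi by exact: psi_ge1.
have De0 : 0 < sigma - lam by rewrite subr_gt0.
set D := 2 * LA * LZ * (nR%:R * psi) ^+ 2.
have D0 : 0 <= D by rewrite mulr_ge0 ?sqr_ge0// mulr_ge0// mulr_ge0.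
have x0 : 0 <= x by rewrite mulr_ge0// divr_ge0// ltW.
have ob0 : 0 < omega_bar nR lam LA LZ LC sigma by exact: le_lt_trans omlt.
have y0 : 0 < y by rewrite subr_gt0 ltr_pdivrMr// mul1r.
(* The threshold acts here: [y > 0] says that the contraction margin [sigma - lam] exceeds the
   quantization feedback [x * (sigma - lam + D)]. *)
have yE : y * (sigma - lam) = (sigma - lam) - x * (sigma - lam + D).
  rewrite /y /omega_bar -/psi -/D /x; field.
  by rewrite !gt_eqF//= ltr_wpDr.
have GE : G = 1 - x + x * ((1 + LC * sigma) * psi).
  by rewrite /G /x; field; rewrite gt_eqF.
have G0 : 0 <= G.
  rewrite GE addr_ge0// ?subr_ge0 ?(ltW x1)// mulr_ge0// mulr_ge0//.
    by rewrite addr_ge0// mulr_ge0// ltW.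
  exact: le_trans psi1.
have psi0 : 0 <= psi by exact: le_trans psi1.
have MV : M <= V.
  rewrite lerDl mulr_ge0//; last by rewrite divr_ge0// ltW.
  by rewrite divr_ge0 ?(ltW De0)// !mulr_ge0// sqr_ge0.
split=> //.
(* The second summand of [V], multiplied by [y * (sigma - lam)], is exactly the left-hand side. *)
have Vy : LA * psi * h * nR%:R ^+ 2 * G <= V * (y * (sigma - lam)).
  have -> : V * (y * (sigma - lam)) =
      M * (y * (sigma - lam)) + LA * psi * h * nR%:R ^+ 2 * G.
    by rewrite /V; field; rewrite !gt_eqF.
  by rewrite lerDr !mulr_ge0// ltW.
have q0 : 0 < 1 - x by rewrite subr_gt0.
rewrite -(ler_pM2r q0).
have -> : LA * (nR%:R * ((h + om * N) * (nR%:R * psi))) * (1 - x) =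
    LA * psi * h * nR%:R ^+ 2 * G + x * D * V.
  have -> : LA * (nR%:R * ((h + om * N) * (nR%:R * psi))) * (1 - x) =
     LA * nR%:R ^+ 2 * psi * (h * (1 - x) + om * (b * (nR%:R * psi))).
    by rewrite /N; field; rewrite gt_eqF.
  by rewrite GE /D /b /x; field; rewrite gt_eqF.
have -> : (sigma - lam) * V * (1 - x) = V * (y * (sigma - lam)) + x * D * V.
  by rewrite yE; ring.
by rewrite lerD2r.
Qed.

End Constants.

(** * Joint Lipschitz bound for the aggregation and unfolding of the algorithm *)

Lemma aggregation_lipschitz (R : realType) (p a b nR : nat)
    (nrm : 'rV[R]_p -> R) (f : ('I_nR -> 'M[R]_(a, b)) -> 'rV[R]_p) (L : R) :
  is_norm nrm ->
  (forall s c c', (forall t, t != s -> c t = c' t) ->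
     nrm (f c - f c') <= L * norm2 (c s - c' s)) ->
  forall c c', nrm (f c - f c') <= L * \sum_s norm2 (c s - c' s).
Proof.
move=> [nrmD nrmZ _] fL c c'.
have nrm0 : nrm 0 = 0 by rewrite -(scale0r 0) nrmZ normr0 mul0r.
(* Hybrid argument: [hyb n] takes its first [n] arguments from [c] and the others from [c'], so
   consecutive hybrids differ in one argument only. *)
pose hyb n (s : 'I_nR) := if (s < n)%N then c s else c' s.
have H n : (n <= nR)%N ->
    nrm (f (hyb n) - f c') <= L * \sum_(s < nR | (s < n)%N) norm2 (c s - c' s).
  elim: n => [_|n ih nnR].
    have -> : hyb 0 = c' by apply/funext => s.
    by rewrite subrr nrm0 big_pred0// mulr0.
  pose s := Ordinal nnR.
  rewrite (bigD1 s)//= mulrDr -(subrK (f (hyb n)) (f (hyb n.+1))) -addrA.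
  apply: le_trans (nrmD _ _) _; apply: lerD.
    have cs : hyb n.+1 s = c s by rewrite /hyb ltnSn.
    have c's : hyb n s = c' s by rewrite /hyb ltnn.
    rewrite -[in leRHS]cs -[in leRHS]c's; apply: fL => t ts.
    by rewrite /hyb ltnS leq_eqVlt (negPf (ts : (t != n :> nat))).
  apply: le_trans (ih (ltnW nnR)) _; rewrite le_eqVlt; apply/orP; left.
  apply/eqP; congr (_ * _); apply: eq_bigl => t.
  by rewrite ltnS ltn_neqAle andbC -val_eqE.
have := H _ (leqnn nR); rewrite (_ : hyb nR = c); last first.
  by apply/funext => s; rewrite /hyb ltn_ord.
by under eq_bigl do rewrite ltn_ord.
Qed.

Section Algorithm.
Variables (R : realType) (p m d nR : nat).
Variables (C : 'I_nR -> 'rV[R]_p -> 'M[R]_(m, d) -> 'M[R]_(m, d)).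
Variables (A : 'rV[R]_p -> ('I_nR -> 'M[R]_(m, d)) -> 'rV[R]_p).
Variables (z0 : 'rV[R]_p) (q : nat -> 'I_nR -> 'I_m -> 'rV[R]_d -> 'rV[R]_d).

Definition qm_in (k n : nat) : 'M[R]_(m, d) :=
  qinner C (qm_z C A z0 q k) (qm_prev C A z0 q k) (q k) n.

(** Indexed by naturals, like [qm_in], so that position 0 exists and holds the zero input of the
    first round. The value 0 at [k = 0] encodes the initial messages of iteration -1. *)
Definition qm_in_prev (k n : nat) : 'M[R]_(m, d) :=
  if k is k'.+1 then qm_in k' n else 0.

Definition qm_err (k : nat) (s : 'I_nR) : 'M[R]_(m, d) :=
  qm_chat C A z0 q k s - qm_c C A z0 q k s.

Lemma qm_zS k : qm_z C A z0 q k.+1 = A (qm_z C A z0 q k) (qm_chat C A z0 q k).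
Proof. by rewrite /qm_z /qm_chat /=; case: qm_state. Qed.

Lemma qm_chatE k s : qm_chat C A z0 q k s = qm_in k s.+1.
Proof. by rewrite /qm_chat /qm_in /qm_z /qm_prev /=; case: qm_state. Qed.

Lemma qm_cE k s : qm_c C A z0 q k s = C s (qm_z C A z0 q k) (qm_in k s).
Proof. by rewrite /qm_c /qm_in /qm_z /qm_prev; case: qm_state. Qed.

Lemma qm_inS k n (lt_n : (n < nR)%N) :
  qm_in k n.+1 = qm_chat C A z0 q k (Ordinal lt_n).
Proof. by rewrite qm_chatE. Qed.

Lemma qm_in_prevS k n (lt_n : (n < nR)%N) :
  qm_in_prev k n.+1 = qm_prev C A z0 q k (Ordinal lt_n).
Proof. by case: k => [//|k]; rewrite /qm_in_prev (qm_inS k lt_n). Qed.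

Lemma qm_errE k s : qm_err k s =
  blockQ (q k s) (qm_c C A z0 q k s - qm_prev C A z0 q k s)
    - (qm_c C A z0 q k s - qm_prev C A z0 q k s).
Proof.
rewrite /qm_err qm_chatE /qm_in /= (valK s) -/(qm_in k s) -qm_cE.
by rewrite opprB addrCA addrA -addrA.
Qed.

(** Puts the error of agent [i] in the form that the BC-rule controls. *)
Lemma row_qm_err k s i :
  let x := row i (qm_c C A z0 q k s - qm_prev C A z0 q k s) in
  row i (qm_err k s) = q k s i x - x.
Proof. by rewrite /= qm_errE [LHS]linearB; congr (_ - _); exact: rowK. Qed.

End Algorithm.

(** * Propagation of the L2 bounds over rounds and iterations *)

Section Convergence.
Context {d0 : measure_display} {T : measurableType d0} {R : realType}.
Variable P : probability T R.
Variables (m d p nR : nat) (Z : set 'rV[R]_p).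
Variables (C : 'I_nR -> 'rV[R]_p -> 'M[R]_(m, d) -> 'M[R]_(m, d)).
Variables (A : 'rV[R]_p -> ('I_nR -> 'M[R]_(m, d)) -> 'rV[R]_p).
Variables (nrm : 'rV[R]_p -> R) (zinf z0 : 'rV[R]_p) (lam LA LC LZ : R).
Variables (q : T -> nat -> 'I_nR -> 'I_m -> 'rV[R]_d -> 'rV[R]_d).
Variables (sigma h om V : R).
Hypothesis A_Z : forall z c, Z z -> Z (A z c).
Hypothesis z0_Z : Z z0.
Hypothesis lam_ge0 : 0 <= lam.
Hypothesis nrm_norm : is_norm nrm.
Hypothesis norm2_le_nrm : forall x, norm2 x <= nrm x.
Hypothesis A_contract : forall z, Z z ->
  nrm (Atilde C A z - zinf) <= lam * nrm (z - zinf).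
Hypothesis LA_ge0 : 0 <= LA.
Hypothesis A_lip : forall s z (c c' : 'I_nR -> 'M[R]_(m, d)), Z z ->
  (forall t, t != s -> c t = c' t) ->
  nrm (A z c - A z c') <= LA * norm2 (c s - c' s).
Hypothesis LC_ge0 : 0 <= LC.
Hypothesis LZ_ge0 : 0 <= LZ.
Hypothesis C_lip : forall s z c c', Z z ->
  norm2 (C s z c - C s z c') <= LC * norm2 (c - c').
Hypothesis C_lipZ : forall s z z' c, Z z -> Z z' ->
  norm2 (C s z c - C s z' c) <= LZ * norm2 (z - z').
Hypothesis sigma01 : 0 < sigma < 1.
Hypothesis h_ge0 : 0 <= h.
Hypothesis om01 : 0 <= om <= 1.
Hypothesis om_lt : nR%:R * (om / sigma) < 1.

Let zk k w := qm_z C A z0 (q w) k.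
Let dev k s w :=
  norm2 (qm_c C A z0 (q w) k s - qm_prev C A z0 (q w) k s).
Let err k s w := norm2 (qm_err C A z0 (q w) k s).
Let b := (1 + sigma * LC) * h / sigma + 2 * LZ * V / sigma.
Let nu s := round_gain b (2 * LC) (1 - om / sigma) s.
Let N := b * (nR%:R * (psi_const nR LC / (1 - nR%:R * (om / sigma)))).

Hypothesis err_L2 : forall k s v, L2_dominated P (dev k s) v ->
  L2_dominated P (err k s) (h * sigma ^+ k + om * v).
Hypothesis V_ge0 : 0 <= V.
Hypothesis z0_V : nrm (z0 - zinf) <= V.
Hypothesis C0_V : forall s, norm2 (C s z0 0) <= LZ * V.
Hypothesis V_large :
  LA * (nR%:R * ((h + om * N) * (nR%:R * psi_const nR LC))) <=
  (sigma - lam) * V.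

Lemma qm_z_in k w : Z (zk k w).
Proof. by elim: k => [//|k ih]; rewrite /zk qm_zS; exact: A_Z. Qed.

Let nrm_ge0 x : 0 <= nrm x.
Proof. exact: le_trans (norm2_ge0 _) (norm2_le_nrm _). Qed.

Let sigma_gt0 : 0 < sigma. Proof. by have /andP[] := sigma01. Qed.
Let om_ge0 : 0 <= om. Proof. by have /andP[] := om01. Qed.

Let b_ge0 : 0 <= b.
Proof.
have s0 := ltW sigma_gt0.
by rewrite addr_ge0// divr_ge0// mulr_ge0// ?addr_ge0// mulr_ge0.
Qed.

Lemma feedback_lt1 : (0 < nR)%N -> 0 < 1 - om / sigma.
Proof.
move=> nR0; rewrite subr_gt0; apply: le_lt_trans om_lt.
by rewrite ler_peMl ?divr_ge0// ?ler1n// ltW.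
Qed.

Lemma nu_ge0 s : (0 < nR)%N -> 0 <= nu s.
Proof.
move=> nR0; apply: round_gain_ge0 => //; first by rewrite mulr_ge0.
exact: ltW (feedback_lt1 nR0).
Qed.

Lemma nu_leN (s : 'I_nR) : nu s <= N.
Proof. by apply: round_gain_le => //; rewrite divr_ge0// ltW. Qed.

(* Part of [dev k s] inherited from the previous iteration, before the change
   of the input within the current round is taken into account. *)
Let base k s w :=
  norm2 (C s (zk k w) (qm_in_prev C A z0 (q w) k s)
         - qm_prev C A z0 (q w) k s).

(** The messages of iteration -1 are zero, so only [norm2 (C s z0 0)] remains; the factor
    [2 / sigma] is slack that matches the shape of [baseS_L2]. *)
Lemma base0_L2 s : L2_dominated P (base 0 s) (2 * LZ * V / sigma).
Proof.
apply: L2_dominated_le (L2_dominated_cst P (_ : 0 <= LZ * V)) _ _.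
- by rewrite mulr_ge0.
- by move=> w; rewrite norm2_ge0 /base /= /qm_prev /= subr0.
- rewrite ler_pdivlMr// -!mulrA [leRHS]mulrCA; apply: ler_wpM2l => //.
  have /andP[_ s1] := sigma01.
  apply: (@le_trans _ _ (V * 1)); first by rewrite ler_wpM2l// ltW.
  by rewrite mulr1 ler_peMl// ler1n.
Qed.

(** The message of round [s] at iteration [k] is inserted. It has the same inner input, so one part
    costs only the move of [z], and the other is the quantization error of iteration [k]. *)
Lemma baseS_L2 k s :
  L2_dominated P (fun w => nrm (zk k w - zinf)) (V * sigma ^+ k) ->
  L2_dominated P (fun w => nrm (zk k.+1 w - zinf)) (V * sigma ^+ k.+1) ->
  L2_dominated P (dev k s) (nu s * sigma ^+ k) ->
  L2_dominated P (base k.+1 s)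
    (((h + om * nu s) / sigma + 2 * LZ * V / sigma) * sigma ^+ k.+1).
Proof.
move=> zk_L2 zk1_L2 dev_L2.
have e_L2 := err_L2 dev_L2.
apply: L2_dominated_le
  (L2_dominatedD e_L2 (L2_dominatedZ LZ_ge0 (L2_dominatedD zk1_L2 zk_L2))) _ _.
- move=> w; rewrite norm2_ge0 andTb [leRHS]addrC.
  apply: le_trans (norm2_dist _ (C s (zk k w) (qm_in C A z0 (q w) k s)) _) _.
  apply: lerD; last by rewrite -qm_cE norm2_sub; exact: lexx.
  apply: le_trans (C_lipZ _ _ (qm_z_in _ _) (qm_z_in _ _)) _.
  apply: ler_wpM2l => //; apply: le_trans (norm2_dist _ zinf _) _.
  by apply: lerD => //; rewrite norm2_sub.
- have -> : ((h + om * nu s) / sigma + 2 * LZ * V / sigma) * sigma ^+ k.+1 =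
     h * sigma ^+ k + om * (nu s * sigma ^+ k) + LZ * (2 * V * sigma ^+ k).
    by rewrite exprS; field; rewrite gt_eqF.
  rewrite lerD2l ler_wpM2l// exprS.
  (* Going through [zinf] costs [V * (sigma + 1) * sigma ^+ k]; [sigma <= 1] turns this into the
     factor 2 of [b]. *)
  have -> : 2 * V * sigma ^+ k = 1 * (V * sigma ^+ k) + V * sigma ^+ k by ring.
  rewrite lerD2r mulrCA ler_wpM2r ?mulr_ge0 ?exprn_ge0 ?(ltW sigma_gt0)//.
  by have /andP[_ /ltW] := sigma01.
Qed.

(** Induction over the rounds: the input changes by at most [err] plus [dev] of the preceding round,
    and not at all in the first. The bound on [base] contains [nu s] itself, hence the coefficient
    [1 - om / sigma] in the recursion. *)
Lemma dev_L2 k :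
  (forall s : 'I_nR, L2_dominated P (base k s)
    (((h + om * nu s) / sigma + 2 * LZ * V / sigma) * sigma ^+ k)) ->
  forall s : 'I_nR, L2_dominated P (dev k s) (nu s * sigma ^+ k).
Proof.
move=> base_L2.
have dev_le s w : dev k s w <= base k s w +
    LC * norm2 (qm_in C A z0 (q w) k s - qm_in_prev C A z0 (q w) k s).
  rewrite addrC; apply: le_trans (norm2_dist _ (C s (zk k w) (qm_in_prev C A z0 (q w) k s)) _) _.
  by rewrite lerD2r qm_cE; apply: C_lip; exact: qm_z_in.
have sk0 : 0 <= sigma ^+ k by rewrite exprn_ge0// ltW.
have bE : b = h / sigma + 2 * LZ * V / sigma + LC * h.
  by rewrite /b; field; rewrite gt_eqF.
suff H n (nnR : (n < nR)%N) :
    L2_dominated P (dev k (Ordinal nnR)) (nu n * sigma ^+ k).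
  by move=> [s snR]; exact: H.
have q_gt0 : 0 < 1 - om / sigma by apply: feedback_lt1; exact: leq_trans nnR.
elim: n => [|n ih] in nnR *; set s := Ordinal nnR.
- apply: L2_dominated_le (base_L2 s) _ _ => [w|].
    rewrite norm2_ge0; apply: le_trans (dev_le _ _) _.
    have -> : qm_in_prev C A z0 (q w) k s = 0 by case: (k).
    by rewrite subrr norm2_0 mulr0 addr0.
  apply: ler_wpM2r => //.
  have := round_gain0 b (2 * LC) (lt0r_neq0 q_gt0); rewrite -/(nu 0) /= => nu0.
  have nuE : nu 0 = b + om * nu 0 / sigma by rewrite -nu0; ring.
  rewrite [leRHS]nuE bE -subr_ge0.
  have -> : h / sigma + 2 * LZ * V / sigma + LC * h + om * nu 0 / sigma -
    ((h + om * nu 0) / sigma + 2 * LZ * V / sigma) = LC * h by ring.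
  exact: mulr_ge0.
- have nnR' := ltnW nnR.
  have := L2_dominatedD (base_L2 s) (L2_dominatedZ LC_ge0
    (L2_dominatedD (err_L2 (ih nnR')) (ih nnR'))).
  move=> /L2_dominated_le; apply => [w|].
    rewrite norm2_ge0; apply: le_trans (dev_le _ _) _.
    rewrite lerD2l ler_wpM2l//= (qm_inS _ _ _ _ _ nnR') (qm_in_prevS _ _ _ _ _ nnR').
    exact: norm2_dist.
  have := round_gainS b (2 * LC) n (lt0r_neq0 q_gt0).
  rewrite -/(nu n) -/(nu n.+1) => nuS.
  have nuE : nu n.+1 = b + 2 * LC * nu n + om * nu n.+1 / sigma.
    by rewrite -nuS; ring.
  rewrite [in leRHS]nuE [in leRHS]bE -subr_ge0 /=.
  (* The slack is that of [LC * (1 + om) <= 2 * LC], which holds since [om <= 1]. *)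
  set D := (X in 0 <= X).
  have -> : D = LC * ((1 - om) * nu n) * sigma ^+ k by rewrite /D; ring.
  have om1 : 0 <= 1 - om by rewrite subr_ge0; have /andP[] := om01.
  have nun : 0 <= nu n by apply: nu_ge0; exact: leq_trans nnR'.
  by rewrite mulr_ge0// mulr_ge0// mulr_ge0.
Qed.

(** The new iterate is compared with [Atilde] at the old one: contraction handles [Atilde], and the
    Lipschitz bound of [A] handles the accumulated quantization errors. *)
Lemma zk_step k :
  L2_dominated P (fun w => nrm (zk k w - zinf)) (V * sigma ^+ k) ->
  (forall s : 'I_nR, L2_dominated P (dev k s) (nu s * sigma ^+ k)) ->
  L2_dominated P (fun w => nrm (zk k.+1 w - zinf)) (V * sigma ^+ k.+1).
Proof.
move=> zk_L2 dk_L2.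
have sk0 : 0 <= sigma ^+ k by rewrite exprn_ge0// ltW.
pose tau := (h + om * N) * sigma ^+ k.
have e_L2 s : L2_dominated P (err k s) tau.
  apply: L2_dominated_le (err_L2 (dk_L2 s)) _ _ => [w|].
    by rewrite norm2_ge0 lexx.
  by rewrite /tau mulrDl lerD2l -mulrA ler_wpM2l// ler_wpM2r// nu_leN.
(* Both chains start at 0 and use the same iterate; each round multiplies the earlier discrepancy by
   at most [LC] and adds one quantization error. *)
have in_L2 n : (n <= nR)%N -> L2_dominated P
    (fun w => norm2 (qm_in C A z0 (q w) k n - cchain C (zk k w) n))
    (tau * \sum_(j < n) LC ^+ j).
  elim: n => [_|n ih nnR].
    rewrite big_ord0 mulr0.
    apply: L2_dominated_le (L2_dominated_cst P (lexx 0)) _ (lexx _) => w.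
    by rewrite subrr norm2_0 lexx.
  pose s := Ordinal nnR.
  apply: L2_dominated_le (L2_dominatedD (e_L2 s) (L2_dominatedZ LC_ge0 (ih (ltnW nnR)))) _ _.
    move=> w; rewrite norm2_ge0 (qm_inS _ _ _ _ _ nnR) /= insubT.
    apply: le_trans (norm2_dist _ (qm_c C A z0 (q w) k s) _) _.
    by rewrite lerD2l qm_cE; apply: C_lip; exact: qm_z_in.
  rewrite big_ord_recl expr0 mulrDr mulr1 lerD2l !mulr_sumr.
  by under [in leRHS]eq_bigr do rewrite lift0 exprS mulrCA.
have diff_L2 : L2_dominated P
    (fun w => \sum_s norm2 (qm_chat C A z0 (q w) k s - cchain C (zk k w) s.+1))
    (\sum_(s < nR) tau * (\sum_(j < s.+1) LC ^+ j)).
  apply: L2_dominated_sum => s; apply: L2_dominated_le (in_L2 s.+1 (ltn_ord s)) _ (lexx _).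
  by move=> w; rewrite norm2_ge0 qm_chatE lexx.
apply: L2_dominated_le
  (L2_dominatedD (L2_dominatedZ LA_ge0 diff_L2) (L2_dominatedZ lam_ge0 zk_L2)) _ _.
  move=> w; rewrite nrm_ge0 /=.
  have [nrmD _ _] := nrm_norm.
  have A_agg : nrm (zk k.+1 w - Atilde C A (zk k w)) <= LA *
      \sum_s norm2 (qm_chat C A z0 (q w) k s - cchain C (zk k w) s.+1).
    rewrite /zk qm_zS; apply: (aggregation_lipschitz nrm_norm) => s c c'.
    by apply: A_lip; exact: qm_z_in.
  apply: le_trans (lerD A_agg (A_contract (qm_z_in k w))).
  by rewrite -{1}(subrK (Atilde C A (zk k w)) (zk k.+1 w)) -addrA nrmD.
have tau0 (s : 'I_nR) : 0 <= tau by have [Y []] := e_L2 s.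
have sum_le : \sum_(s < nR) tau * (\sum_(j < s.+1) LC ^+ j) <=
    nR%:R * (tau * (nR%:R * psi_const nR LC)).
  rewrite mulr_natl -[X in _ *+ X](card_ord nR) -sumr_const; apply: ler_sum => s _.
  apply: ler_wpM2l; first exact: tau0 s.
  apply: (@le_trans _ _ (\sum_(j < s.+1) psi_const nR LC)).
    apply: ler_sum => j _; apply: (@le_trans _ _ ((2 * LC) ^+ j)).
      by rewrite lerXn2r ?nnegrE ?mulr_ge0// ler_peMl// ler1n.
    by apply: geometric_le_psi => //; exact: leq_trans (ltn_ord j) (ltn_ord s).
  rewrite sumr_const card_ord -[leLHS]mulr_natl; apply: ler_wpM2r.
    exact: le_trans (psi_ge1 _ _).
  by rewrite ler_nat.
apply: (@le_trans _ _ ((sigma - lam) * V * sigma ^+ k + lam * (V * sigma ^+ k))).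
  rewrite lerD2r; apply: le_trans (ler_wpM2l LA_ge0 sum_le) _.
  apply: le_trans (ler_wpM2r sk0 V_large).
  by rewrite /tau le_eqVlt; apply/orP; left; apply/eqP; ring.
by rewrite exprS le_eqVlt; apply/orP; left; apply/eqP; ring.
Qed.

(** The induction is joint: the bounds at [k] give the next iterate, and both iterates together with
    [dev] at [k] give [dev] at [k.+1]. *)
Lemma qm_z_L2 k :
  L2_dominated P (fun w => nrm (zk k w - zinf)) (V * sigma ^+ k).
Proof.
suff [] : L2_dominated P (fun w => nrm (zk k w - zinf)) (V * sigma ^+ k) /\
    forall s : 'I_nR, L2_dominated P (dev k s) (nu s * sigma ^+ k) by [].
elim: k => [|k [zk_L2 dk_L2]].
  split.
    rewrite expr0 mulr1.
    apply: L2_dominated_le (L2_dominated_cst P V_ge0) _ (lexx _) => w.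
    by rewrite nrm_ge0.
  apply: dev_L2 => s; apply: L2_dominated_le (base0_L2 s) _ _ => [w|].
    by rewrite norm2_ge0 lexx.
  rewrite expr0 mulr1 lerDr divr_ge0 ?(ltW sigma_gt0)// addr_ge0// mulr_ge0//.
  by apply: nu_ge0; exact: leq_trans (ltn_ord s).
have zk1_L2 := zk_step zk_L2 dk_L2.
by split=> //; apply: dev_L2 => s; exact: baseS_L2.
Qed.

End Convergence.

(** * Assembly from the conditional BC-rule *)

Lemma mx_measurable_wrt_entry {d0 : measure_display} {T : measurableType d0}
    (R : realType) (G : set (set T)) (a b : nat) (X : T -> 'M[R]_(a, b)) :
  G `<=` measurable -> mx_measurable_wrt G X ->
  forall i j, measurable_fun setT (fun w => X w i j).
Proof. by move=> GT mX i j _ B mB; rewrite setTI; exact/GT/mX. Qed.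

Theorem theorem2
  (R : realType) (d0 : measure_display) (T : measurableType d0)
  (P : probability T R)
  (m d p nR : nat) (Z : set 'rV[R]_p)
  (C : 'I_nR -> 'rV[R]_p -> 'M[R]_(m, d) -> 'M[R]_(m, d))
  (A : 'rV[R]_p -> ('I_nR -> 'M[R]_(m, d)) -> 'rV[R]_p)
  (nrm : 'rV[R]_p -> R) (zinf z0 : 'rV[R]_p) (lam LA LC LZ : R)
  (Q : nat -> 'I_nR -> 'I_m -> T -> 'rV[R]_d -> 'rV[R]_d)
  (F : nat -> 'I_nR -> set (set T))
  (sigma eta0 om : R) :
  (0 < m)%N -> (0 < d)%N -> (0 < p)%N -> (0 < nR)%N ->
  (* standing setting: A maps Z x (R^{md})^R into Z; z^0 in Z *)
  (forall z c, Z z -> Z (A z c)) -> Z z0 ->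
  (* (A1) *)
  Z zinf -> Atilde C A zinf = zinf -> 0 < lam < 1 ->
  is_norm nrm -> (forall x, norm2 x <= nrm x) ->
  (forall z, Z z -> nrm (Atilde C A z - zinf) <= lam * nrm (z - zinf)) ->
  (* (A2) *)
  0 <= LA ->
  (forall (s : 'I_nR) z (c c' : 'I_nR -> 'M[R]_(m, d)), Z z ->
     (forall t, t != s -> c t = c' t) ->
     nrm (A z c - A z c') <= LA * norm2 (c s - c' s)) ->
  (* (A3) *)
  0 <= LC -> 0 <= LZ ->
  (forall s z c c', Z z -> norm2 (C s z c - C s z c') <= LC * norm2 (c - c')) ->
  (forall s z z' c, Z z -> Z z' ->
     norm2 (C s z c - C s z' c) <= LZ * norm2 (z - z')) ->
  0 < LZ ->
  lam < sigma < 1 -> 0 < eta0 ->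
  0 <= om < omega_bar nR lam LA LZ LC sigma ->
  (* F k s : the information (sigma-algebra) generated before the quantizer
     application of round s of iteration k; it contains all previously
     generated random variables and the current input *)
  (forall k s, sigma_algebra setT (F k s) /\ F k s `<=` measurable) ->
  (forall k (s : 'I_nR) k', (k' <= k)%N ->
     mx_measurable_wrt (F k s) (fun w => qm_z C A z0 (qsample Q w) k')) ->
  (forall k (s : 'I_nR) k' (s' : 'I_nR), before k' s' k s ->
     mx_measurable_wrt (F k s) (fun w => qm_chat C A z0 (qsample Q w) k' s')) ->
  (forall k (s : 'I_nR) k' (s' : 'I_nR), before k' s' k s || ((k' == k) && (s' == s)) ->
     mx_measurable_wrt (F k s) (fun w => qm_c C A z0 (qsample Q w) k' s')) ->
  (* BC-rule with bias eta0 * sigma^k and rate om, for each application of a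
     quantizer, conditionally on the previously generated random variables:
     E[ ||Q(x)-x||^2 | F ] <= (sqrt d * eta + om ||x||)^2, written as
     integrals over every event B of F *)
  (forall k (s : 'I_nR) (i : 'I_m) (B : set T), F k s B ->
     let x := fun w => row i (qm_c C A z0 (qsample Q w) k s
                              - qm_prev C A z0 (qsample Q w) k s) in
     (\int[P]_(w in B) ((norm2 (Q k s i w (x w) - x w)) ^+ 2)%:E <=
      \int[P]_(w in B)
         ((Num.sqrt d%:R * (eta0 * sigma ^+ k) + om * norm2 (x w)) ^+ 2)%:E)%E) ->
  let psi := psi_const nR LC in
  let cstar := LZ^-1 * \big[Num.max/0]_(s < nR) norm2 (C s z0 0) in
  let V0 := Num.max cstar (nrm (z0 - zinf)) +
            LA * psi * Num.sqrt (m * d)%:R * nR%:R ^+ 2 * eta0 / (sigma - lam) *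
            ((1 + nR%:R * om / sigma * ((1 + LC * sigma) * psi - 1)) /
             (1 - om / omega_bar nR lam LA LZ LC sigma)) in
  (* sqrt(E ||z^k - z^inf||_2^2) <= V0 sigma^k, squared (both sides >= 0) *)
  forall k : nat,
    (\int[P]_w ((norm2 (qm_z C A z0 (qsample Q w) k - zinf)) ^+ 2)%:E <=
     ((V0 * sigma ^+ k) ^+ 2)%:E)%E.
Proof.
move=> m0 d_gt0 p0 nR0 A_Z z0_Z zinf_Z zinf_fix lam01 nrm_norm norm2_nrm A_contract
  LA0 A_lip LC0 LZ_ge0 C_lip C_lipZ LZ0 /andP[ls s1] eta0_gt0 omb F_sigma Fz Fchat Fc BC
  psi cstar V0 k.
have /andP[lam0 _] := lam01; have /andP[om0 _] := omb.
have s0 : 0 < sigma by exact: lt_trans ls.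
have lams : 0 < lam < sigma by rewrite lam0.
(* Collects [Num.sqrt m%:R] from summing the blocks and [Num.sqrt d%:R] from the bias. *)
pose h : R := Num.sqrt (m * d)%:R * eta0.
have h0 : 0 <= h by rewrite mulr_ge0 ?sqrtr_ge0// ltW.
have x_lt1 := omega_bar_rate nR0 lams LA0 LZ_ge0 omb.
have om1 : om <= 1.
  have : om / sigma < 1.
    apply: le_lt_trans x_lt1.
    by rewrite ler_peMl ?ler1n// divr_ge0// ltW.
  by rewrite ltr_pdivrMr// mul1r => /ltW os; exact: le_trans os (ltW s1).
have bigmax_ge0 : 0 <= \big[Num.max/0]_(s < nR) norm2 (C s z0 0).
  by apply: le_trans (le_bigmax _ _ (Ordinal nR0)); exact: norm2_ge0.
have M0 : 0 <= Num.max cstar (nrm (z0 - zinf)).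
  by rewrite le_max mulr_ge0// invr_ge0.
have [MV V_large] := V0_dominates nR0 lams LA0 LC0 LZ_ge0 omb h0 M0.
have V0E : V0 = Num.max cstar (nrm (z0 - zinf)) +
    LA * psi * h * nR%:R ^+ 2 / (sigma - lam) *
    ((1 + nR%:R * om / sigma * ((1 + LC * sigma) * psi - 1)) /
     (1 - om / omega_bar nR lam LA LZ LC sigma)).
  by rewrite /V0 /h; congr (_ + _ * _); ring.
rewrite -V0E in MV V_large.
have V0_ge0 : 0 <= V0 by exact: le_trans MV.
(* On the event [setT] the conditional BC-rule becomes an inequality between plain expectations. *)
have setT_F k' s : F k' s setT.
  have [[F0 FC _] _] := F_sigma k' s.
  by rewrite -(setD0 setT); exact: FC.
have err_L2 k' s v :
    L2_dominated P (fun w => norm2 (qm_c C A z0 (qsample Q w) k' s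
                                    - qm_prev C A z0 (qsample Q w) k' s)) v ->
    L2_dominated P (fun w => norm2 (qm_err C A z0 (qsample Q w) k' s))
      (h * sigma ^+ k' + om * v).
  have mc i j : measurable_fun setT (fun w => qm_c C A z0 (qsample Q w) k' s i j).
    apply: mx_measurable_wrt_entry (F_sigma k' s).2 _ i j.
    by apply: Fc; rewrite !eqxx orbT.
  have mchat k'' i j :
      measurable_fun setT (fun w => qm_chat C A z0 (qsample Q w) k'' s i j).
    (* Messages of iteration [k''] precede every round of iteration [k''.+1]. *)
    apply: mx_measurable_wrt_entry (F_sigma k''.+1 s).2 _ i j.
    by apply: Fchat; rewrite /before ltnSn.
  have mprev i j :
      measurable_fun setT (fun w => qm_prev C A z0 (qsample Q w) k' s i j).
    by case: k' {mc} => [|k'']; [exact: measurable_cst | exact: mchat].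
  have -> : h * sigma ^+ k' =
      Num.sqrt m%:R * (Num.sqrt d%:R * (eta0 * sigma ^+ k')).
    by rewrite /h natrM sqrtrM// !mulrA.
  apply: quantization_error_L2 => //.
  - by rewrite mulr_ge0 ?sqrtr_ge0// mulr_ge0 ?exprn_ge0// ltW.
  - move=> i j; under eq_fun do rewrite mxE [X in _ + X]mxE.
    exact: measurable_funB.
  - move=> i j; under eq_fun do rewrite mxE [X in _ + X]mxE.
    apply: measurable_funB => //; exact: mchat.
  - move=> i; under eq_integral do rewrite row_qm_err.
    exact: BC.
apply: L2_dominated_integral.
  apply: measurable_norm2 => i j; under eq_fun do rewrite mxE.
  apply: measurable_funD => //.
  exact: mx_measurable_wrt_entry (F_sigma k (Ordinal nR0)).2 (Fz _ _ _ (leqnn k)) i j.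
apply: L2_dominated_le
  (qm_z_L2 (Z := Z) (q := qsample Q) (h := h) (om := om) _ _ _ nrm_norm
     norm2_nrm A_contract LA0 A_lip LC0 LZ_ge0 C_lip C_lipZ _ h0 _ x_lt1 err_L2
     V0_ge0 _ _ V_large k) _ (lexx _) => //.
- exact: ltW.
- by rewrite s0.
- by rewrite om0.
- by apply: le_trans MV; rewrite le_max lexx orbT.
(* This is the purpose of [cstar] in [V0]: it controls the messages of the first iteration. *)
- move=> s; rewrite -ler_pdivrMl//; apply: le_trans MV.
  rewrite le_max; apply/orP; left; rewrite ler_wpM2l ?invr_ge0//.
  exact: le_bigmax.
- by move=> w; rewrite norm2_ge0 norm2_nrm.
Qed.
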